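(* Let $B$ be any algorithm (online or offline) for the $k$-server problem on the line and let $\pi=\pi^{\textsc{greedy},B}$. Then there is a constant $\eta$ (independent of $n$) such that for all $n$ and all $\sigma\in\mathcal{I}_n$, $\textsc{greedy}(\sigma)\le\frac{4k}{3}B(\pi(\sigma))+\eta$. Moreover, with $\pi=\pi^{\textsc{greedy},\textsc{k-Center}}$, there is a constant $\eta$ such that $\textsc{greedy}(\sigma)\le\frac{2k}{3}\textsc{k-Center}(\pi(\sigma))+\eta$ for all $\sigma$.
   Context: The line $[0,1]$ is discretized into equally spaced points at distance $\delta>0$, with $\delta$ chosen so that the points $i/(2k)$, $i=0,\dots,2k$, are among them. $k$ servers occupy points; a request is a point to which an algorithm must move a server; cost is total distance moved; algorithms start from the same initial configuration. $\mathcal{I}_n$ is the set of request sequences of length $n$. $\textsc{greedy}$ serves each request by moving the closest server. $\textsc{k-Center}$ anchors its servers at $i/(2k)$ for each odd $i$, serves each request with the closest server, which then returns to its anchor. For a configuration $C$ and point $p$, $D^{\min}_C(p)$ is the distance from $p$ to the nearest server of $C$; $\mathcal{P}^\delta_C$ is the sequence of all points ordered by nondecreasing $D^{\min}_C$ (ties broken arbitrarily). The ordered bijection of configurations $C_1,C_2$ maps $\mathcal{P}^\delta_{C_1}[j]$ to $\mathcal{P}^\delta_{C_2}[j]$ for all $j$. For algorithms $A,B$, $\pi^{A,B}(\sigma)=\pi_1(\sigma[1])\cdots\pi_n(\sigma[n])$, where $\pi_i$ is the ordered bijection of the configuration of $A$ after serving $\sigma[1,i-1]$ and the configuration of $B$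 after serving $\pi_1(\sigma[1])\cdots\pi_{i-1}(\sigma[i-1])$.
   Formalization: Assumes k ≥ 2 and that the initial configuration has k distinct server positions (the claim fails otherwise); for offline B, π(σ) is any sequence τ with τ[i] = π_i(σ[i]), where π_i uses B's configurations in its run on all of τ. *)

(* Defs.v *)
From HB Require Import structures.
From mathcomp Require Import all_boot all_order all_algebra.
Set Implicit Arguments.
Unset Strict Implicit.
Unset Printing Implicit Defensive.
Import Order.TTheory GRing.Theory Num.Theory.
Local Open Scope ring_scope.

(* The discretized line with spacing delta = 1 / N: [p] stands for p * delta. *)
Definition point (N : nat) := 'I_N.+1.

Definition config (k N : nat) := {ffun 'I_k -> point N}.

Definition move k N (C : config k N) (j : 'I_k) (p : point N) : config k N :=
  [ffun j' => if j' == j then p else C j'].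

(* The argument of [serving] and [resting] is the whole input, so a behaviour
   may depend on future requests (offline algorithms); see [online]. While
   handling request i (counted from 0) the servers go from [resting tau i] to
   [serving tau i], where some server is at the request, and then to
   [resting tau i.+1]; the last two differ for an algorithm that moves servers
   again after serving. *)
Record algorithm k N (c0 : config k N) := Algorithm {
  serving : seq (point N) -> nat -> config k N;
  resting : seq (point N) -> nat -> config k N;
  resting0 : forall tau, resting tau 0 = c0;
  servingP : forall tau i, (i < size tau)%N ->
    exists j, serving tau i j = nth ord0 tau i
}.

Definition online k N (c0 : config k N) (A : algorithm c0) : Prop :=
  forall tau rho,
    (forall i, (i < size tau)%N -> serving A (tau ++ rho) i = serving A tau i)
    /\ (forall i, (i <= size tau)%N ->
          resting A (tau ++ rho) i = resting A tau i).

Section Line.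

Variables (R : realFieldType) (k N : nat).
Implicit Types (C : config k N) (p : point N).

Definition pos p : R := p%:R / N%:R.

(* The grid contains every point i / (2k); this forces N > 0 when k > 0. *)
Definition fine_grid : Prop :=
  forall i, (i <= 2 * k)%N -> exists p, pos p = i%:R / (2 * k)%N%:R.

Definition dist p q : R := `|pos p - pos q|.

Definition config_dist C C' : R := \sum_(j < k) dist (C j) (C' j).

(* All distances are at most 1, so the neutral element 1 never matters. *)
Definition Dmin C p : R := \big[Num.min/1]_(j < k) dist p (C j).

Definition closest C p (j : 'I_k) : Prop := dist p (C j) = Dmin C p.

Definition cost (c0 : config k N) (A : algorithm c0) (tau : seq (point N)) : R :=
  \sum_(i < size tau)
     (config_dist (resting A tau i) (serving A tau i)
      + config_dist (serving A tau i) (resting A tau i.+1)).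

Definition serves_with_closest (c0 : config k N) (A : algorithm c0) : Prop :=
  forall tau i, (i < size tau)%N ->
    exists2 j, closest (resting A tau i) (nth ord0 tau i) j
             & serving A tau i = move (resting A tau i) j (nth ord0 tau i).

Definition is_greedy (c0 : config k N) (A : algorithm c0) : Prop :=
  [/\ online A, serves_with_closest A
    & forall tau i, (i < size tau)%N -> resting A tau i.+1 = serving A tau i].

Definition anchored C : Prop :=
  forall j : 'I_k, pos (C j) = (2 * j + 1)%N%:R / (2 * k)%N%:R.

(* The initial configuration c0 need not be anchored: all the servers take up
   their anchors when the first request is handled, and from then on only the
   serving one moves. *)
Definition is_kcenter (c0 : config k N) (A : algorithm c0) : Prop :=
  [/\ online A, serves_with_closest A
    & forall tau i, (i < size tau)%N -> anchored (resting A tau i.+1)].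

(* [P C] lists all points by nondecreasing Dmin; P fixes the ties. *)
Definition distance_ordering (P : config k N -> seq (point N)) : Prop :=
  forall C, perm_eq (P C) (enum 'I_N.+1)
    /\ sorted (fun p q => Dmin C p <= Dmin C q) (P C).

Definition ordered_bij (P : config k N -> seq (point N)) C1 C2 p : point N :=
  nth p (P C2) (index p (P C1)).

(* tau = pi^{A,B}(sigma). This is a relation because, for an offline B, the
   configurations of B depend on all of tau; for online algorithms it is the
   graph of a function, by [pi_image_online]. *)
Definition pi_image (P : config k N -> seq (point N)) (c0 : config k N)
    (A B : algorithm c0) n (sigma tau : n.-tuple (point N)) : Prop :=
  forall i : 'I_n,
    tnth tau i =
    ordered_bij P (resting A sigma i) (resting B tau i) (tnth sigma i).

Lemma pi_image_online P (c0 : config k N) (A B : algorithm c0) n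
    (sigma : n.-tuple (point N)) :
  online A -> online B -> exists! tau, pi_image P A B sigma tau.
Proof.
move=> onA onB.
pose good (s t : seq (point N)) := size t = size s /\
  forall i, (i < size s)%N -> nth ord0 t i =
    ordered_bij P (resting A s i) (resting B t i) (nth ord0 s i).
have goodE m (s t : m.-tuple (point N)) : pi_image P A B s t <-> good s t.
  split=> [h|[_ h] i].
    split=> [|i]; first by rewrite !size_tuple.
    rewrite size_tuple => lt_im; have := h (Ordinal lt_im).
    by rewrite !(tnth_nth ord0).
  by rewrite !(tnth_nth ord0) h // size_tuple.
have step s x t y : size t = size s -> good (rcons s x) (rcons t y) <->
    good s t /\ y = ordered_bij P (resting A s (size s)) (resting B t (size t)) x.
  move=> sz; rewrite /good !size_rcons -!cats1.
  have rA i : (i <= size s)%N -> resting A (s ++ [:: x]) i = resting A s i.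
    exact: (onA s [:: x]).2.
  have rB i : (i <= size s)%N -> resting B (t ++ [:: y]) i = resting B t i.
    by rewrite -sz; exact: (onB t [:: y]).2.
  split=> [[_ h]|[[_ h] ->]].
    split; [split=> // i lti|].
      have := h i (leqW lti).
      by rewrite !nth_cat sz lti rA ?rB // ltnW.
    have := h (size s) (ltnSn _).
    by rewrite !nth_cat sz ltnn subnn /= rA // rB.
  split=> [|i]; first by rewrite sz.
  rewrite ltnS => lei.
  rewrite rA //.
  have -> : resting B (t ++ [:: ordered_bij P (resting A s (size s))
      (resting B t (size t)) x]) i = resting B t i.
    by apply: (onB t _).2; rewrite sz.
  rewrite !nth_cat sz; case: ltnP => [/h //|gei].
  have -> : i = size s by apply/eqP; rewrite eqn_leq lei gei.
  by rewrite subnn /=.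
have ex1 s : exists t, good s t /\ forall t', good s t' -> t = t'.
  elim/last_ind: s => [|s x [t [gt ut]]].
    by exists [::]; split=> [|t' [/size0nil->]].
  exists (rcons t
    (ordered_bij P (resting A s (size s)) (resting B t (size t)) x)).
  split; first by apply/step; [case: gt|].
  case/lastP=> [[]|t' y g']; first by rewrite size_rcons.
  have sz' : size t' = size s by case: g'; rewrite !size_rcons => -[].
  by case/(step _ _ _ _ sz'): g' => /ut <- ->.
have [t [gt ut]] := ex1 sigma.
have szt : size t == n by case: gt => ->; rewrite size_tuple.
exists (Tuple szt); split; first exact/goodE.
by move=> t' /goodE /ut e; apply: val_inj.
Qed.

End Line.

(* Main.v *)
(** A request at distance [d] from greedy's servers is paired with one at
    distance [e] from the servers of [B] (in units of the grid), both having the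
    same rank [r] in their distance orderings. At most [k (2 e + 1)] points are
    within distance [e] of [k] servers, so [r < k (2 e + 1)]. On the other side
    [r] is at least the number of points closer than [d] to greedy's servers,
    which are always distinct: at least [k + (d - 1)] if the request is outside
    their hull, and [k + 2 (d - 1)] if it is inside. With the spread of greedy's
    configuration (its rightmost minus its leftmost position) as potential,
    which grows by [d] in the first case and drops by at most [d] in the second,
    both cases give [3 d <= 4 k e + (increase of the spread)]. Finally [B] pays
    at least [e], and k-center, which travels back to its anchor, pays
    [2 e]. *)

Require Import Defs.
From HB Require Import structures.
From mathcomp Require Import all_boot all_order all_algebra.
From mathcomp Require Import zify lra.
Import Order.TTheory GRing.Theory Num.Theory.
Local Open Scope ring_scope.
Set Implicit Arguments.
Unset Strict Implicit.
Unset Printing Implicit Defensive.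

(** * Counting the points of an interval of the grid *)

Lemma card_ord_itv (n a m : nat) :
  (a + m <= n)%N -> #|[set q : 'I_n | (a <= q < a + m)%N]| = m.
Proof.
move=> le_n; rewrite cardE -(size_map val) -[RHS](size_iota a m).
apply: perm_size; apply: uniq_perm.
- by rewrite map_inj_uniq ?enum_uniq //; exact: val_inj.
- exact: iota_uniq.
move=> x; rewrite mem_iota; apply/mapP/idP => [[q]|hx].
  by rewrite mem_enum inE => hq ->.
have lt_xn : (x < n)%N by lia.
by exists (Ordinal lt_xn) => //; rewrite mem_enum inE.
Qed.

Lemma card_ord_itv_le (n a m : nat) :
  (#|[set q : 'I_n | (a <= q < a + m)%N]| <= m)%N.
Proof.
rewrite cardE -(size_map val) -[leqRHS](size_iota a m).
apply: uniq_leq_size => [|x /mapP[q]].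
  by rewrite map_inj_uniq ?enum_uniq //; exact: val_inj.
by rewrite mem_enum inE mem_iota => hq ->.
Qed.

(** * Ranks in a sorted enumeration with arbitrary ties *)

Section Ranking.

Variables (T : finType) (f : T -> nat) (s : seq T).
Hypothesis s_perm : perm_eq s (enum T).
Hypothesis s_sorted : sorted (fun p q => (f p <= f q)%N) s.

Let mem_s x : x \in s.
Proof. by rewrite (perm_mem s_perm) mem_enum. Qed.

Let uniq_s : uniq s.
Proof. by rewrite (perm_uniq s_perm) enum_uniq. Qed.

Lemma leq_ranking p q : (index p s <= index q s)%N -> (f p <= f q)%N.
Proof.
move=> le_pq.
have tr : transitive (fun p q => (f p <= f q)%N).
  by move=> ? ? ?; apply: leq_trans.
have := sorted_leq_nth tr (fun x => leqnn (f x)) p s_sorted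
  (index p s) (index q s).
by rewrite !inE !index_mem !mem_s => /(_ isT isT le_pq); rewrite !nth_index.
Qed.

(** Only strictly smaller values are sure to precede [p], whatever the ties; the companion upper
    bound therefore counts the equal values too. *)
Lemma card_below_leq_index p : (#|[set q | (f q < f p)%N]| <= index p s)%N.
Proof.
have -> : index p s = size (take (index p s) s).
  by rewrite size_takel // ltnW // index_mem.
rewrite cardE; apply: uniq_leq_size => [|q]; first exact: enum_uniq.
rewrite mem_enum inE in_take // ltnNge; apply: contraR; rewrite -leqNgt.
exact: leq_ranking.
Qed.

Lemma index_lt_card_upto p : (index p s < #|[set q | (f q <= f p)%N]|)%N.
Proof.
have -> : (index p s).+1 = size (take (index p s).+1 s).
  by rewrite size_takel // index_mem.
rewrite cardE; apply: uniq_leq_size => [|q]; first exact: take_uniq.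
by rewrite mem_enum inE in_take // ltnS; exact: leq_ranking.
Qed.

End Ranking.

(** * Servers and distances in grid units *)

Section Grid.

Variables (k N : nat).
Implicit Types (C : config k N) (p q : point N).

(** Subtraction truncates, so one summand vanishes and the other is the absolute difference. *)
Definition gap p q : nat := (p - q + (q - p))%N.

Definition nearest C p : nat := \big[Order.min/N]_(j < k) gap p (C j).

Definition spread C : nat := \max_(ij : 'I_k * 'I_k) (C ij.1 - C ij.2)%N.

Lemma nearest_le C p j : (nearest C p <= gap p (C j))%N.
Proof. exact: (@bigmin_le_cond _ nat _ _ _ predT). Qed.

Lemma nearest_leN C p : (nearest C p <= N)%N.
Proof. exact: (@bigmin_le_id _ nat). Qed.

Lemma nearest_attained C p :
  (0 < k)%N -> exists j, nearest C p = gap p (C j).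
Proof.
move=> k_gt0.
have le j : xpredT j -> (gap p (C j) <= N)%O.
  by move=> _; rewrite leEnat /gap; have := ltn_ord p; have := ltn_ord (C j); lia.
exists [arg min_(i < Ordinal k_gt0) gap p (C i)]%O.
exact: (@bigmin_eq_arg _ nat _ _ _ xpredT).
Qed.

Lemma card_ball_le C e :
  (0 < k)%N -> (#|[set q | (nearest C q <= e)%N]| <= k * (2 * e + 1))%N.
Proof.
move=> k_gt0.
(* Near the left border [C j - e] truncates to 0 and the interval exceeds the true ball, which is
   harmless for an upper bound. *)
pose ball j := [set q : point N | (C j - e <= q < C j - e + (2 * e + 1))%N].
apply: (@leq_trans #|\bigcup_j ball j|).
  apply/subset_leq_card/subsetP => q; rewrite inE => hq.
  have [j hj] := nearest_attained C q k_gt0.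
  apply/bigcupP; exists j => //; rewrite inE; move: hq; rewrite hj /gap; lia.
apply: (@leq_trans (\sum_(j < k) (2 * e + 1))); last first.
  by rewrite sum_nat_const card_ord.
elim/big_ind2: _ => [|x A y B hA hB|j _]; first by rewrite cards0.
  by apply: leq_trans (leq_add hA hB); rewrite cardsU leq_subr.
exact: card_ord_itv_le.
Qed.

Definition server_below C p := [exists j, C j < p]%N.
Definition server_above C p := [exists j, p < C j]%N.

(** With [d] the distance from [p] to the servers, the [d - 1] points right after the last server
    below [p] stay below [p], are closer than [d] to that server, and are free because it is the
    last one. *)
Lemma free_below C p : (0 < nearest C p)%N -> server_below C p ->
  exists2 A : {set point N}, #|A| = (nearest C p).-1 &
    forall q, q \in A -> [/\ (q < p)%N, (nearest C q < nearest C p)%N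
                           & forall j, C j != q].
Proof.
move=> d_gt0 /existsP[j0 hj0].
case: (@arg_maxnP _ j0 (fun j => C j < p)%N (fun j => C j) hj0) => i hi imax.
have := nearest_le C p i; rewrite /gap => hd; have ltp := ltn_ord p.
set d := nearest C p in d_gt0 hd *.
exists [set q : 'I_N.+1 | ((C i).+1 <= q < (C i).+1 + d.-1)%N].
  by apply: card_ord_itv; lia.
move=> q; rewrite inE => hq; split; first by lia.
  by apply: leq_ltn_trans (nearest_le C q i) _; rewrite /gap; lia.
move=> j; apply/eqP => ej.
by have := imax j; rewrite ej => /(_ ltac:(lia)); lia.
Qed.

Lemma free_above C p : (0 < nearest C p)%N -> server_above C p ->
  exists2 A : {set point N}, #|A| = (nearest C p).-1 &
    forall q, q \in A -> [/\ (p < q)%N, (nearest C q < nearest C p)%N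
                           & forall j, C j != q].
Proof.
move=> d_gt0 /existsP[j0 hj0].
case: (@arg_minnP _ j0 (fun j => p < C j)%N (fun j => C j) hj0) => i hi imin.
have := nearest_le C p i; rewrite /gap => hd; have ltCi := ltn_ord (C i).
set d := nearest C p in d_gt0 hd *.
exists [set q : 'I_N.+1 | ((C i).+1 - d <= q < (C i).+1 - d + d.-1)%N].
  by apply: card_ord_itv; lia.
move=> q; rewrite inE => hq; split; first by lia.
  by apply: leq_ltn_trans (nearest_le C q i) _; rewrite /gap; lia.
move=> j; apply/eqP => ej.
by have := imin j; rewrite ej => /(_ ltac:(lia)); lia.
Qed.

Lemma card_below_nearest C p : injective C -> (0 < nearest C p)%N ->
  (k + (nearest C p).-1 * (server_below C p + server_above C p)
     <= #|[set q | (nearest C q < nearest C p)%N]|)%N.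
Proof.
move=> injC d_gt0; set d := nearest C p in d_gt0 *.
have [A cA hA] : exists2 A : {set point N}, #|A| = (d.-1 * server_below C p)%N &
    forall q, q \in A -> [/\ (q < p)%N, (nearest C q < d)%N
                           & forall j, C j != q].
  case: (boolP (server_below C p)) => [/(free_below d_gt0)|_].
    by rewrite muln1.
  by exists set0; rewrite ?cards0 ?muln0 // => q; rewrite inE.
have [B cB hB] : exists2 A : {set point N}, #|A| = (d.-1 * server_above C p)%N &
    forall q, q \in A -> [/\ (p < q)%N, (nearest C q < d)%N
                           & forall j, C j != q].
  case: (boolP (server_above C p)) => [/(free_above d_gt0)|_].
    by rewrite muln1.
  by exists set0; rewrite ?cards0 ?muln0 // => q; rewrite inE.
have cS : #|C @: setT| = k by rewrite card_imset // cardsT card_ord.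
have AB0 : A :&: B = set0.
  apply/setP => q; rewrite !inE; apply/negP => /andP[/hA[h _ _] /hB[h' _ _]].
  by lia.
have S0 : (C @: setT) :&: (A :|: B) = set0.
  apply/setP => q; rewrite !inE; apply/negP => /andP[/imsetP[j _ ->]].
  by case/orP => [/hA|/hB] [_ _ /(_ j)]; rewrite eqxx.
(* Subtracting the empty intersections turns the sum of sizes into the size of the union. *)
rewrite mulnDr -cS -cA -cB -[(#|A| + _)%N]subn0 -[in leqLHS](cards0 (point N)).
rewrite -AB0 -cardsU -[leqLHS]subn0 -[in leqLHS](cards0 (point N)) -S0 -cardsU.
apply/subset_leq_card/subsetP => q; rewrite !inE => /orP[/imsetP[j _ ->]|].
  by apply: leq_ltn_trans (nearest_le C _ j) _; rewrite /gap; lia.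
by case/orP => [/hA|/hB] [].
Qed.

(** * The potential and one step of greedy *)

Lemma spread_ge C i j : (C i - C j <= spread C)%N.
Proof.
exact: (leq_bigmax (F := fun ij : 'I_k * 'I_k => C ij.1 - C ij.2)%N (i, j)).
Qed.

Lemma spread_leN C : (spread C <= N)%N.
Proof. by apply/bigmax_leqP => -[i j] _ /=; have := ltn_ord (C i); lia. Qed.

Lemma moveE C j p i : move C j p i = if i == j then p else C i.
Proof. by rewrite ffunE. Qed.

Lemma spread_move_ge C j p :
  (spread C <= spread (move C j p) + gap p (C j))%N.
Proof.
apply/bigmax_leqP => -[i1 i2] _ /=.
have := spread_ge (move C j p) i1 i2; rewrite !moveE /gap.
by case: eqP => [->|_]; case: eqP => [->|_]; lia.
Qed.

(** The closest server is an extreme one and moves outwards; a second server is needed to hold the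
    other end. *)
Lemma spread_move_outside C j p :
  (1 < k)%N -> nearest C p = gap p (C j) ->
  ~~ (server_below C p && server_above C p) ->
  (spread C + gap p (C j) <= spread (move C j p))%N.
Proof.
move=> k_gt1 hj out.
have hn i : (gap p (C j) <= gap p (C i))%N by rewrite -hj nearest_le.
have [i0 i0j] : exists i0 : 'I_k, i0 != j.
  have := cardC1 j; rewrite card_ord => hc.
  have /card_gt0P[i] : (0 < #|predC1 j|)%N by rewrite hc; lia.
  by exists i.
have ge i : i != j -> (gap p (C i) <= spread (move C j p))%N.
  move=> ij; have := spread_ge (move C j p) i j.
  have := spread_ge (move C j p) j i.
  rewrite !moveE eqxx (negbTE ij) /gap.
  move: out; rewrite negb_and => /orP[] /existsPn /(_ i); lia.
have h0 := leq_trans (hn i0) (ge _ i0j).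
(* [h0] makes this truncated subtraction exact. *)
suff: (spread C <= spread (move C j p) - gap p (C j))%N by lia.
apply/bigmax_leqP => -[i1 i2] _ /=.
have g1 : i1 != j -> (gap p (C i1) <= spread (move C j p))%N by exact: ge.
have g2 : i2 != j -> (gap p (C i2) <= spread (move C j p))%N by exact: ge.
have := hn i1; have := hn i2; move: g1 g2 h0.
by move: out; rewrite negb_and => /orP[] /existsPn h;
  have := h i1; have := h i2; have := h j;
  case: (eqVneq i1 j) => [->|_]; case: (eqVneq i2 j) => [->|_]; rewrite /gap;
  lia.
Qed.

(** Write [d] and [e] for the two distances. Inside the hull, [d <= k e] and the spread loses at
    most [d]: the charge is [3 d + d]. Outside, only [d <= 2 k e] holds, but the spread gains [d]:
    the charge is [3 d - d]. The weight 3 makes both at most [4 k e]. *)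
Lemma greedy_step C C' j p q r :
  (1 < k)%N -> injective C -> nearest C p = gap p (C j) ->
  (#|[set x | (nearest C x < nearest C p)%N]| <= r)%N ->
  (r < #|[set x | (nearest C' x <= nearest C' q)%N]|)%N ->
  (3 * nearest C p + spread C
     <= 4 * k * nearest C' q + spread (move C j p))%N.
Proof.
move=> k_gt1 injC hj ler ltr.
have hball := @card_ball_le C' (nearest C' q) (ltnW k_gt1).
have hin := spread_move_ge C j p; rewrite -hj in hin.
case: (posnP (nearest C p)) => [|d_gt0]; first by lia.
have hcount := card_below_nearest injC d_gt0.
have hrank : (k + (nearest C p).-1 * (server_below C p + server_above C p)
    < k * (2 * nearest C' q + 1))%N by lia.
case: (boolP (server_below C p && server_above C p)) => [/andP[b a]|out].
  (* [2 d - 1 <= 2 k e] improves to [d <= k e] by parity. *)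
  by move: hrank; rewrite b a /=; nia.
have hout := spread_move_outside k_gt1 hj out; rewrite -hj in hout.
have side : server_below C p || server_above C p.
  apply/orP; have := hj; rewrite /gap; case: (ltngtP (C j) p) => h e.
  - by left; apply/existsP; exists j.
  - by right; apply/existsP; exists j.
  - by lia.
have hside : (1 <= server_below C p + server_above C p)%N by lia.
have : ((nearest C p).-1
          <= (nearest C p).-1 * (server_below C p + server_above C p))%N.
  by rewrite leq_pmulr.
by move: hrank; nia.
Qed.

(** If a server is already at [p], the closest distance is 0 and injectivity makes it the moved one,
    so greedy never stacks servers. *)
Lemma move_inj C j p :
  injective C -> nearest C p = gap p (C j) -> injective (move C j p).
Proof.
move=> injC hj.
have clash i : C i = p -> i = j.
  move=> ei; apply: injC; apply: val_inj.
  by have := nearest_le C p i; rewrite hj ei /gap /=; lia.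
move=> i1 i2; rewrite !moveE.
case: eqP => [->|_]; case: eqP => [->|_] //.
- by move=> /esym /clash ->.
- by move=> /clash ->.
- exact: injC.
Qed.

End Grid.

(** * From grid units to costs in the field *)

Section Costs.

Variables (R : realFieldType) (k N : nat).
Hypothesis N_gt0 : (0 < N)%N.
Implicit Types (C : config k N) (p q : point N).

Let N_pos : 0 < N%:R :> R.
Proof. by rewrite ltr0n. Qed.

Lemma distE p q : dist R p q = (gap p q)%:R / N%:R.
Proof.
rewrite /dist /pos -mulrBl normrM normfV (gtr0_norm N_pos) /gap natrD.
case: (leqP p q) => h.
  rewrite distrC ger0_norm ?subr_ge0 ?ler_nat // -natrB //.
  by rewrite (eqP (h : p - q == 0)%N) add0r.
have h' := ltnW h; rewrite ger0_norm ?subr_ge0 ?ler_nat // -natrB //.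
by rewrite (eqP (h' : q - p == 0)%N) addr0.
Qed.

Lemma DminE C p : Dmin R C p = (nearest C p)%:R / N%:R.
Proof.
rewrite /Dmin /nearest; apply/esym.
(* Division by [N] commutes with minima and sends the default [N] of [nearest] to the default 1 of
   [Dmin]. *)
rewrite (@big_morph _ _ (fun n : nat => n%:R / N%:R : R) 1 Num.min N Order.min).
- by apply: eq_bigr => j _; rewrite distE.
- move=> a b; rewrite !minElt ltr_pM2r ?invr_gt0 // ltr_nat ltEnat.
  by rewrite /=; case: (a < b)%N.
- by rewrite divff // gt_eqF.
Qed.

Lemma closestE C p j : closest R C p j -> nearest C p = gap p (C j).
Proof.
rewrite /closest distE DminE => /(mulIf _) h; apply/esym/eqP.
by rewrite -(eqr_nat R); apply/eqP/h; rewrite invr_eq0 gt_eqF.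
Qed.

Lemma dist_ge0 p q : 0 <= dist R p q.
Proof. exact: normr_ge0. Qed.

Lemma dist_sym p q : dist R p q = dist R q p.
Proof. exact: distrC. Qed.

Lemma config_distC C C' : config_dist R C C' = config_dist R C' C.
Proof. by apply: eq_bigr => j _; rewrite dist_sym. Qed.

Lemma config_dist_ge0 C C' : 0 <= config_dist R C C'.
Proof. by apply: sumr_ge0 => j _; exact: dist_ge0. Qed.

Lemma config_dist_self C : config_dist R C C = 0.
Proof. by apply: big1 => j _; rewrite /dist subrr normr0. Qed.

Lemma config_dist_move C j p : config_dist R C (move C j p) = dist R p (C j).
Proof.
rewrite /config_dist (bigD1 j) //= big1 ?addr0 => [|i /negbTE ij].
  by rewrite moveE eqxx dist_sym.
by rewrite moveE ij /dist subrr normr0.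
Qed.

Lemma config_dist_serve C C' j p :
  C' j = p -> (nearest C p)%:R / N%:R <= config_dist R C C'.
Proof.
move=> <-; apply: (@le_trans _ _ (dist R (C j) (C' j))).
  by rewrite dist_sym distE ler_pM2r ?invr_gt0 // ler_nat nearest_le.
by rewrite /config_dist (bigD1 j) //= lerDl sumr_ge0 // => i _; exact: dist_ge0.
Qed.

(** Exactly what greedy pays for request [i], and a lower bound for any algorithm, up to the factor
    [1 / N]. *)
Definition unit_cost (c0 : config k N) (A : algorithm c0) tau i : nat :=
  nearest (resting A tau i) (nth ord0 tau i).

Lemma greedy_costE (c0 : config k N) (A : algorithm c0) tau :
  is_greedy R A ->
  cost R A tau = (\sum_(i < size tau) unit_cost A tau i)%:R / N%:R.
Proof.
case=> _ clA stA; rewrite natr_sum mulr_suml; apply: eq_bigr => i _.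
have [j hj e] := clA tau i (ltn_ord i).
rewrite stA // config_dist_self addr0 e config_dist_move hj.
exact: DminE.
Qed.

Lemma cost_ge (c0 : config k N) (A : algorithm c0) tau :
  (\sum_(i < size tau) unit_cost A tau i)%:R / N%:R <= cost R A tau.
Proof.
rewrite natr_sum mulr_suml; apply: ler_sum => i _.
have [j hj] := servingP A (ltn_ord i).
apply: le_trans (config_dist_serve _ hj) _.
by rewrite lerDl config_dist_ge0.
Qed.

Lemma anchored_inj C C' : anchored R C -> anchored R C' -> C = C'.
Proof.
move=> aC aC'; apply/ffunP => j; apply: val_inj; apply/eqP.
rewrite -(eqr_nat R); apply/eqP.
have := aC j; rewrite -(aC' j) /pos => /(mulIf _); apply.
by rewrite invr_eq0 gt_eqF.
Qed.

(* The only step without a return trip is the first, as c0 need not be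
   anchored; it accounts for the additive 1. *)
Lemma kcenter_cost_ge (c0 : config k N) (A : algorithm c0) tau :
  is_kcenter R A ->
  2 * ((\sum_(i < size tau) unit_cost A tau i)%:R / N%:R) <= cost R A tau + 1.
Proof.
case=> _ _ ancA; rewrite natr_sum mulr_suml mulr_sumr /cost.
pose F i := config_dist R (resting A tau i) (serving A tau i)
  + config_dist R (serving A tau i) (resting A tau i.+1).
pose u i := (unit_cost A tau i)%:R / N%:R : R.
have serve i : (i < size tau)%N ->
    u i <= config_dist R (resting A tau i) (serving A tau i).
  by move=> /(servingP A)[j hj]; exact: config_dist_serve hj.
have first : (0 < size tau)%N -> 2 * u 0%N <= F 0%N + 1.
  move=> /serve; rewrite /F.
  have := config_dist_ge0 (serving A tau 0) (resting A tau 1).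
  have : u 0%N <= 1 by rewrite ler_pdivrMr // mul1r ler_nat nearest_leN.
  by lra.
(* Both surrounding resting configurations are anchored, hence equal: the way back is as long as the
   way out. *)
have later i : (i.+1 < size tau)%N -> 2 * u i.+1 <= F i.+1.
  move=> lti; have := serve _ lti; rewrite /F.
  rewrite (anchored_inj (ancA _ _ lti) (ancA _ _ (ltnW lti))).
  by rewrite (config_distC (serving _ _ _)); lra.
rewrite -/(\sum_(i < size tau) F i).
case: (size tau) first later => [_ _|m first later].
  by rewrite !big_ord0; lra.
rewrite [leRHS]addrC !big_ord_recl addrA [1 + _]addrC.
by apply: lerD; [exact: first | apply: ler_sum => i _; exact: later (ltn_ord i)].
Qed.

(** * Summing the steps along the paired sequences *)

Section Amortization.

Variables (P : config k N -> seq (point N)) (c0 : config k N).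
Variables (greedy B : algorithm c0).
Hypotheses (k_gt1 : (1 < k)%N) (hP : distance_ordering R P).
Hypotheses (c0_inj : injective c0) (greedyP : is_greedy R greedy).

Lemma orderingP C : perm_eq (P C) (enum (point N)) /\
  sorted (fun p q => (nearest C p <= nearest C q)%N) (P C).
Proof.
have [pP sP] := hP C; split=> //; apply: sub_sorted sP => p q.
by rewrite !DminE ler_pM2r ?invr_gt0 // ler_nat.
Qed.

Lemma greedy_next sigma i : (i < size sigma)%N ->
  exists2 j, nearest (resting greedy sigma i) (nth ord0 sigma i)
             = gap (nth ord0 sigma i) (resting greedy sigma i j)
           & resting greedy sigma i.+1
             = move (resting greedy sigma i) j (nth ord0 sigma i).
Proof.
move=> lti; have [_ cl st] := greedyP; rewrite st //.
by have [j /closestE hj e] := cl _ _ lti; exists j.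
Qed.

Lemma greedy_inj sigma i :
  (i <= size sigma)%N -> injective (resting greedy sigma i).
Proof.
elim: i => [_|i IHi lti]; first by rewrite resting0.
have [j hj ->] := greedy_next lti.
by apply: move_inj => //; apply: IHi; exact: ltnW.
Qed.

Lemma greedy_amortized n (sigma tau : n.-tuple (point N)) :
  pi_image P greedy B sigma tau ->
  (3 * (\sum_(i < n) unit_cost greedy sigma i)
     <= 4 * k * (\sum_(i < n) unit_cost B tau i) + N)%N.
Proof.
move=> himg.
(* The spread telescopes; at the end the initial one is dropped and the final one is at most [N]. *)
suff main m : (m <= n)%N ->
    (3 * (\sum_(i < m) unit_cost greedy sigma i) + spread c0
     <= 4 * k * (\sum_(i < m) unit_cost B tau i)
        + spread (resting greedy sigma m))%N.
  have := main n (leqnn n); have := spread_leN (resting greedy sigma n); lia.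
elim: m => [_|m IHm ltm]; first by rewrite !big_ord0 resting0 !muln0.
rewrite !big_ord_recr /= !mulnDr.
have ltms : (m < size sigma)%N by rewrite size_tuple.
have [j hj ->] := greedy_next ltms.
have := himg (Ordinal ltm); rewrite !(tnth_nth ord0) /= /ordered_bij => htau.
have [pA sA] := orderingP (resting greedy sigma m).
have [pB sB] := orderingP (resting B tau m).
have ler := card_below_leq_index pA sA (nth ord0 sigma m).
(* Both orderings list every point, so the [nth] in [ordered_bij] never returns its default and the
   paired requests share one rank. *)
have lt_size : (index (nth ord0 sigma m) (P (resting greedy sigma m))
                < size (P (resting B tau m)))%N.
  by rewrite (perm_size pB) -(perm_size pA) index_mem (perm_mem pA) mem_enum.
have := index_lt_card_upto pB sB (nth ord0 tau m).
rewrite {1}htau index_uniq ?(perm_uniq pB) ?enum_uniq // => ltr.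
have := greedy_step k_gt1 (greedy_inj (ltnW ltms)) hj ler ltr.
rewrite -/(unit_cost greedy sigma m) -/(unit_cost B tau m).
move: (IHm (ltnW ltm)) (4 * k * unit_cost B tau m)%N.
by move: (4 * k * \sum_(i < m) _)%N (\sum_(i < m) _)%N => x y h z; lia.
Qed.

End Amortization.

End Costs.

(** * Both competitive bounds *)

Lemma fine_grid_gt0 (R : realFieldType) (k N : nat) :
  (0 < k)%N -> fine_grid R k N -> (0 < N)%N.
Proof.
move=> k_gt0 /(_ (2 * k)%N (leqnn _)) [p].
rewrite /pos divff ?pnatr_eq0; last by lia.
(* For [N = 0] division by zero puts every point at position 0, so position 1 is missed. *)
by case: N p => // p /eqP; rewrite invr0 mulr0 eq_sym oner_eq0.
Qed.

Unset Implicit Arguments.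

Theorem theorem10 (R : realFieldType) (k N : nat)
    (P : config k N -> seq (point N)) (c0 : config k N)
    (greedy : algorithm c0)
    (hk : (1 < k)%N)
    (hgrid : fine_grid R k N)
    (hP : distance_ordering R P)
    (hc0 : injective c0)
    (hgreedy : is_greedy R greedy) :
  (forall B : algorithm c0,
     exists eta : R, forall (n : nat) (sigma tau : n.-tuple (point N)),
       pi_image P greedy B sigma tau ->
       cost R greedy sigma <= (4 * k)%N%:R / 3%:R * cost R B tau + eta)
  /\
  (forall kcenter : algorithm c0, is_kcenter R kcenter ->
     exists eta : R, forall (n : nat) (sigma tau : n.-tuple (point N)),
       pi_image P greedy kcenter sigma tau ->
       cost R greedy sigma <= (2 * k)%N%:R / 3%:R * cost R kcenter tau + eta).
Proof.
have N_gt0 := fine_grid_gt0 (ltnW hk) hgrid.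
(* Dividing by [N] turns the additive [N] into 1. *)
have amortized (B : algorithm c0) n (sigma tau : n.-tuple (point N)) :
    pi_image P greedy B sigma tau -> 3 * cost R greedy sigma <=
      4 * k%:R * ((\sum_(i < size tau) unit_cost B tau i)%:R / N%:R) + 1.
  move=> /(greedy_amortized N_gt0 hk hP hc0 hgreedy).
  rewrite (greedy_costE N_gt0 _ hgreedy) !size_tuple -(ler_nat R).
  rewrite natrD !natrM !mulrA => h.
  have N_neq0 : N%:R != 0 :> R by rewrite pnatr_eq0 -lt0n.
  rewrite -[X in _ + X](divff N_neq0) -mulrDl.
  by rewrite ler_pM2r // invr_gt0 ltr0n.
have k_ge0 : 0 <= k%:R :> R by [].
split=> [B|B hB].
  exists 1 => n sigma tau /amortized h.
  have := ler_wpM2l k_ge0 (cost_ge R N_gt0 B tau).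
  by rewrite natrM; lra.
(* The additive 1 of [kcenter_cost_ge] is multiplied by [2 k], leaving [(2 k + 1) / 3], which is at
   most [1 + k]. *)
exists (1 + k%:R) => n sigma tau /amortized h.
have := ler_wpM2l k_ge0 (kcenter_cost_ge N_gt0 tau hB).
by rewrite natrM; lra.
Qed.
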